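(* Let $1<p<\infty$. Then $$D\left(\left(\oplus_{n=1}^\infty \ell^\infty_n\right)_p\right)\ge 1^+ .$$
   Context: $\ell^\infty_n$ denotes the $n$-dimensional space $\mathbb{R}^n$ with the maximum norm $\|\cdot\|_\infty$. The space $\left(\oplus_{n=1}^\infty \ell^\infty_n\right)_p$ is the $\ell_p$-direct sum: all sequences $x=\{x_n\}_{n=1}^\infty$ with $x_n\in \ell^\infty_n$ and $\|x\|=\left(\sum_{n=1}^\infty\|x_n\|_\infty^p\right)^{1/p}<\infty$. A metric space is locally finite if each ball of finite radius in it has finite cardinality. For $1\le C<\infty$, a map $f:(A,d_A)\to(Y,d_Y)$ between metric spaces is a $C$-bilipschitz embedding if there exists $r>0$ such that $r\,d_A(u,v)\le d_Y(f(u),f(v))\le rC\,d_A(u,v)$ for all $u,v\in A$. A bilipschitz embedding is a map that is $C$-bilipschitz for some such $C$. The distortion of $f$ is the smallest $C$ for which such an $r$ exists. For a Banach space $X$ and a real number $\alpha\ge 1$: (1) $D(X)\le\alpha$ means that, for every $C\in[1,\infty)$ and every locally finite metric space $A$ all of whose finite subsets admit bilipschitz embeddings into $X$ with distortions $\le C$, the space $A$ itself admits a bilipschitz embedding into $X$ with distortion $\le\alpha\cdot C$. (2) $D(X)=\alpha$ means that $\alpha$ is the least number for which $D(X)\le\alpha$. (3) $D(X)=\alpha^+$ means that $D(X)\le\alpha+\varepsilon$ holds for every $\varepsilon>0$, while $D(X)\le\alpha$ does not hold. (4) $D(X)<\alpha^+$ means that either $D(X)=\beta$ for some $\beta\le\alpha$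 or $D(X)=\beta^+$ for some $\beta<\alpha$; $D(X)\ge\alpha^+$ is the negation of this. In particular, $D(X)\ge 1^+$ means that $D(X)\le 1$ does not hold. *)

(* Defs.v *)
From HB Require Import structures.
From mathcomp Require Import all_boot all_order all_algebra.
From mathcomp Require Import all_classical all_reals all_analysis.
From mathcomp Require Import ring.

Set Implicit Arguments.
Unset Strict Implicit.
Unset Printing Implicit Defensive.
Import Order.TTheory GRing.Theory Num.Theory.
Import numFieldNormedType.Exports.
Local Open Scope classical_set_scope.
Local Open Scope ring_scope.

Section psum.
Context (R : realType) (p : R) (p1 : 1 <= p).
Variable E : nat -> completeNormedModType R.
Implicit Types x y : forall n, E n.

Definition psum x : \bar R := (\sum_(n <oo) (`|x n| `^ p)%:E)%E.

Let p_gt0 : 0 < p. Proof. exact: lt_le_trans p1. Qed.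

Let p_neq0 : p != 0. Proof. by rewrite gt_eqF. Qed.

Let pV_neq0 : p^-1 != 0. Proof. by rewrite invr_neq0. Qed.

Lemma psum_ge0 x : (0 <= psum x)%E.
Proof. by apply: nneseries_ge0 => n _ _; rewrite lee_fin powR_ge0. Qed.

Lemma psum_fin x : (psum x < +oo)%E -> psum x \is a fin_num.
Proof. by move=> h; rewrite ge0_fin_numE// psum_ge0. Qed.

Lemma psum_Lnorm x :
  (psum x `^ p^-1)%E = Lnorm counting p%:E (EFin \o (fun n => `|x n|)).
Proof.
rewrite Lnorm_counting//; congr (_ `^ _)%E; apply: eq_eseriesr => n _ /=.
by rewrite normr_id.
Qed.

Lemma psum_triangle x y :
  (psum (fun n => x n + y n)%R `^ p^-1 <= psum x `^ p^-1 + psum y `^ p^-1)%E.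
Proof.
rewrite !psum_Lnorm; apply: le_trans (minkowski_EFin _ _ _ p1) => //.
rewrite !Lnorm_counting//; apply: gt0_ler_poweR.
- by rewrite invr_ge0 ltW.
- rewrite in_itv/= leey andbT.
  by apply: nneseries_ge0 => n _ _ /=; rewrite lee_fin powR_ge0.
- rewrite in_itv/= leey andbT.
  by apply: nneseries_ge0 => n _ _ /=; rewrite lee_fin powR_ge0.
apply: lee_nneseries => n _ /=; first by rewrite lee_fin powR_ge0.
rewrite lee_fin !normr_id ge0_ler_powR ?(ltW p_gt0) ?nnegrE//.
by apply: (le_trans (ler_normD _ _)); rewrite real_ler_norm// realE addr_ge0.
Qed.

Lemma psumD x y :
  (psum x < +oo -> psum y < +oo -> psum (fun n => x n + y n)%R < +oo)%E.
Proof.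
move=> xoo yoo; apply: (lty_poweRy pV_neq0).
by apply: (le_lt_trans (psum_triangle x y)); rewrite lte_add_pinfty ?poweR_lty.
Qed.

Lemma psumZ (a : R) x : psum (fun n => a *: x n) = ((`|a| `^ p)%:E * psum x)%E.
Proof.
rewrite -nneseriesZl; last by move=> n _; rewrite lee_fin powR_ge0.
by apply: eq_eseriesr => n _; rewrite normrZ powRM.
Qed.

Lemma psumN x : psum (fun n => - x n) = psum x.
Proof. by apply: eq_eseriesr => n _; rewrite normrN. Qed.

Lemma psum0 : psum (fun n => 0 : E n) = 0%E.
Proof. by apply: eseries0 => n _ _; rewrite normr0 powR0. Qed.

Lemma psum_ge x n : ((`|x n| `^ p)%:E <= psum x)%E.
Proof.
have h k : predT k -> (0 <= (`|x k| `^ p)%:E)%E.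
  by move=> _; rewrite lee_fin powR_ge0.
apply: (le_trans _ (nneseries_lim_ge n.+1 (fun k _ => h k))).
by rewrite big_nat_recr//= leeDr// sume_ge0.
Qed.

Lemma psum_le x (M : R) :
  (forall N, \sum_(0 <= n < N) `|x n| `^ p <= M) -> (psum x <= M%:E)%E.
Proof.
move=> h; apply: lime_le.
  by apply: is_cvg_nneseries => n _ _; rewrite lee_fin powR_ge0.
by apply: nearW => N; rewrite /= sumEFin lee_fin.
Qed.

Lemma psum_partial x (M : R) N : (psum x <= M%:E)%E ->
  \sum_(0 <= n < N) `|x n| `^ p <= M.
Proof.
move=> h; rewrite -lee_fin; apply: le_trans h.
rewrite -sumEFin; apply: nneseries_lim_ge => n _.
by rewrite lee_fin powR_ge0.
Qed.

End psum.

(* [1 <= p] is a parameter of the type because it is what makes the norm below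
   subadditive. *)
Record lp_sum (R : realType) (p : R) (p1 : 1 <= p)
    (E : nat -> completeNormedModType R) := LpSum {
  lp_sum_val :> forall n, E n ;
  lp_sumP : (psum p lp_sum_val < +oo)%E
}.
Arguments LpSum {R p} p1 {E} _ _.

Section lp_sum_normed.
Context (R : realType) (p : R) (p1 : 1 <= p).
Variable E : nat -> completeNormedModType R.
Local Notation X := (lp_sum p1 E).
Implicit Types x y z : X.

Let p_gt0 : 0 < p. Proof. exact: lt_le_trans p1. Qed.

Let p_neq0 : p != 0. Proof. by rewrite gt_eqF. Qed.

Lemma lp_sum_ext x y : (forall n, x n = y n) -> x = y.
Proof.
case: x y => [x hx] [y hy] /= xy.
have {}xy : x = y by apply: functional_extensionality_dep.
by subst y; congr LpSum; exact: Prop_irrelevance.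
Qed.

HB.instance Definition _ := gen_eqMixin X.
HB.instance Definition _ := gen_choiceMixin X.

Let zero : X.
Proof. by exists (fun=> 0); rewrite psum0. Defined.

Let opp x : X.
Proof. by exists (fun n => - x n); rewrite psumN lp_sumP. Defined.

Let add x y : X.
Proof. by exists (fun n => x n + y n); apply: psumD; rewrite ?lp_sumP. Defined.

Let scale (a : R) x : X.
Proof.
exists (fun n => a *: x n); rewrite psumZ.
by rewrite lte_mul_pinfty ?lee_fin ?powR_ge0 ?lp_sumP.
Defined.

Let addA : associative add.
Proof. by move=> x y z; apply: lp_sum_ext => n /=; rewrite addrA. Qed.

Let addC : commutative add.
Proof. by move=> x y; apply: lp_sum_ext => n /=; rewrite addrC. Qed.

Let add0 : left_id zero add.
Proof. by move=> x; apply: lp_sum_ext => n /=; rewrite add0r. Qed.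

Let addN : left_inverse zero opp add.
Proof. by move=> x; apply: lp_sum_ext => n /=; rewrite addNr. Qed.

HB.instance Definition _ := GRing.isZmodule.Build X addA addC add0 addN.

Let scaleA a b x : scale a (scale b x) = scale (a * b) x.
Proof. by apply: lp_sum_ext => n /=; rewrite scalerA. Qed.

Let scale1 : left_id 1 scale.
Proof. by move=> x; apply: lp_sum_ext => n /=; rewrite scale1r. Qed.

Let scaleDr : right_distributive scale +%R.
Proof. by move=> a x y; apply: lp_sum_ext => n /=; rewrite scalerDr. Qed.

Let scaleDl x : {morph scale^~ x : a b / a + b}.
Proof. by move=> a b; apply: lp_sum_ext => n /=; rewrite scalerDl. Qed.

HB.instance Definition _ :=
  GRing.Zmodule_isLmodule.Build R X scaleA scale1 scaleDr scaleDl.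

Definition lp_sum_norm x : R := fine (psum p x) `^ p^-1.

Let normE x : (lp_sum_norm x)%:E = (psum p x `^ p^-1)%E.
Proof. by rewrite /lp_sum_norm -poweR_EFin fineK// psum_fin ?lp_sumP. Qed.

Let normD x y : lp_sum_norm (x + y) <= lp_sum_norm x + lp_sum_norm y.
Proof.
have := psum_triangle p1 x y.
rewrite -(normE x) -(normE y) -EFinD.
have -> : psum p (fun n => x n + y n) = psum p (x + y) by [].
by rewrite -(normE (x + y)) lee_fin.
Qed.

Let normZ a x : lp_sum_norm (a *: x) = `|a| * lp_sum_norm x.
Proof.
apply: EFin_inj; rewrite (normE (a *: x)) EFinM (normE x).
have -> : psum p (a *: x) = psum p (fun n => a *: x n) by [].
rewrite psumZ poweRM ?psum_ge0 ?lee_fin ?powR_ge0//.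
by rewrite poweR_EFin -powRrM mulfV// powRr1.
Qed.

Let norm_ge x n : `|x n| <= lp_sum_norm x.
Proof.
rewrite /lp_sum_norm -[leLHS]powRr1// -(mulfV p_neq0) powRrM.
rewrite ge0_ler_powR ?invr_ge0 ?(ltW p_gt0)// ?nnegrE ?powR_ge0//.
- by rewrite fine_ge0// psum_ge0.
- by rewrite -lee_fin fineK ?psum_ge// psum_fin ?lp_sumP.
Qed.

Let norm0_eq0 x : lp_sum_norm x = 0 -> x = 0.
Proof.
move=> x0; apply: lp_sum_ext => n /=; apply/eqP; rewrite -normr_le0 -x0.
exact: norm_ge.
Qed.

HB.instance Definition _ := Lmodule_isNormed.Build R X normD normZ norm0_eq0.

Lemma lp_sum_normE x : `|x| = fine (psum p x) `^ p^-1.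
Proof. by []. Qed.

Lemma lp_sumDE x y n : (x + y) n = x n + y n. Proof. by []. Qed.

Lemma lp_sumNE x n : (- x) n = - x n. Proof. by []. Qed.

Lemma lp_sumBE x y n : (x - y) n = x n - y n. Proof. by []. Qed.

Lemma lp_sumZE a x n : (a *: x) n = a *: x n. Proof. by []. Qed.

Lemma lp_sum0E n : (0 : X) n = 0. Proof. by []. Qed.

Lemma lp_sum_norm_coord x n : `|x n| <= `|x|.
Proof. exact: norm_ge. Qed.

Lemma psum_normE x : psum p x = (`|x| `^ p)%:E.
Proof.
rewrite lp_sum_normE -powRrM mulVf// powRr1 ?fine_ge0 ?psum_ge0//.
by rewrite fineK// psum_fin ?lp_sumP.
Qed.

Let powR_lsc (T : Type) (F : set_system T) (FF : ProperFilter F) (f : T -> R)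
    (c d : R) : 0 <= c -> f @ F --> c -> 0 < d ->
  \forall t \near F, c `^ p <= f t `^ p + d.
Proof.
move=> c0 fc d0; have [->|cn0] := eqVneq c 0.
  by apply: nearW => t; rewrite powR0// addr_ge0 ?powR_ge0 ?ltW.
have {cn0}c0 : 0 < c by rewrite lt_neqAle eq_sym cn0.
have cvp : (f t `^ p) @[t --> F] --> c `^ p.
  apply: (@continuous_cvg _ _ _ F _ f (fun a : R => a `^ p) c _ fc).
  apply: differentiable_continuous; apply/derivable1_diffP.
  by apply: derivable_powR; rewrite in_itv/= c0.
have /cvgrPdist_le/(_ d d0) := cvp; apply: filterS => t.
by rewrite ler_distl => /andP[].
Qed.

Let complete (F : set_system X) : ProperFilter F -> cauchy F -> cvg F.
Proof.
move=> FF /cauchy_ballP Fc.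
have Fc' e : 0 < e -> \forall u & v \near F, `|u - v| < e.
  by move=> e0; have := Fc _ e0; rewrite -ball_normE.
have cvn n : cvg ((fun x : X => x n) @ F).
  apply: cauchy_cvg; apply/cauchy_ballP => e e0; rewrite near_map2.
  have := Fc' _ e0; apply: filterS => -[u v] /= uv.
  rewrite -ball_normE /ball_/=.
  by apply: le_lt_trans uv; rewrite -lp_sumBE lp_sum_norm_coord.
pose l n : E n := lim ((fun x : X => x n) @ F).
have close e : 0 < e ->
    \forall u \near F, (psum p (fun n => (u : X) n - l n)%R <= (e `^ p)%:E)%E.
  move=> e0; have : \forall u \near F, \forall v \near F, `|u - v| < e.
    by apply: nearP_dep; exact: Fc'.
  apply: filterS => u uF.
  apply: psum_le => N; apply/ler_addgt0Pr => d d0.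
  pose d' := d / N.+1%:R; have d'0 : 0 < d' by rewrite divr_gt0.
  have H n : \forall v \near F, `|u n - l n| `^ p <= `|u n - (v : X) n| `^ p + d'.
    apply: powR_lsc => //; apply: cvg_norm; apply: cvgB; first exact: cvg_cst.
    exact: cvn.
  have HM M : \forall v \near F, forall n, (n < M)%N ->
      `|u n - l n| `^ p <= `|u n - (v : X) n| `^ p + d'.
    elim: M => [|M IH]; first exact: nearW.
    near=> v => n; rewrite ltnS leq_eqVlt => /predU1P[->|].
      by near: v; exact: H.
    by move: n; near: v; exact: IH.
  have [v [uv Hv]] := filter_ex (filterI uF (HM N)).
  apply: (@le_trans _ _ (\sum_(0 <= n < N) (`|u n - v n| `^ p + d'))).
    by rewrite big_nat_cond [leRHS]big_nat_cond ler_sum// => n /andP[/andP[_ nN] _]; exact: Hv.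
  rewrite big_split/= lerD//.
    apply: (@psum_partial R p E (u - v)).
    rewrite psum_normE lee_fin.
    by apply: ge0_ler_powR; rewrite ?nnegrE//; exact: ltW.
  rewrite sumr_const_nat subn0 -mulr_natr /d' mulrAC ler_pdivrMr//.
  by rewrite ler_pM2l// ler_nat.
have lfin : (psum p l < +oo)%E.
  have [u hu] := filter_ex (close 1 ltr01).
  have -> : l = fun n => u n + - (u n - l n).
    by apply: functional_extensionality_dep => n; rewrite opprB subrKC.
  apply: psumD => //; first exact: lp_sumP.
  by rewrite psumN (le_lt_trans hu)// ltry.
apply/cvg_ex; exists (LpSum p1 l lfin).
apply/(@cvgrPdist_le _ _ _ _ FF id) => e e0.
have := close e e0; apply: filterS => u hu.
rewrite distrC /= -[leLHS]powRr1// -(mulfV p_neq0) powRrM.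
have -> : e = (e `^ p) `^ p^-1 by rewrite -powRrM mulfV// powRr1// ltW.
rewrite ge0_ler_powR ?invr_ge0 ?(ltW p_gt0) ?nnegrE ?powR_ge0//.
by rewrite -lee_fin -psum_normE.
Unshelve. all: by end_near. Qed.

HB.instance Definition _ := Uniform_isComplete.Build X complete.

End lp_sum_normed.

(* MathComp-Analysis norms a matrix by the maximum of the absolute values of
   its entries. *)
Definition linfty (R : realType) (n : nat) : Type := 'rV[R]_n.
HB.instance Definition _ (R : realType) (n : nat) :=
  NormedModule.copy (linfty R n) 'rV[R]_n.
HB.instance Definition _ (R : realType) (n : nat) :=
  Complete.copy (linfty R n) 'rV[R]_n.

Lemma linfty_normE (R : realType) n (x : linfty R n) :
  `|x| = \big[Num.max/0]_(i < n) `|(x : 'rV[R]_n) ord0 i|.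
Proof.
have -> : `|x| = mx_norm (x : 'rV[R]_n) by [].
rewrite mx_normrE; apply/eqP; rewrite eq_le; apply/andP; split.
- apply/bigmax_leP; split=> [|[i j] _ /=]; first exact: bigmax_ge_id.
  by rewrite ord1; exact: (le_bigmax _ (fun j => `|x ord0 j|)).
- apply/bigmax_leP; split=> [|j _]; first exact: bigmax_ge_id.
  exact: (le_bigmax _ (fun ij : 'I_1 * 'I_n => `|x ij.1 ij.2|) (ord0, j)).
Qed.

(* The index is shifted by one: the summands are the spaces of dimension
   1, 2, 3, and so on. *)
Definition lp_sum_linfty (R : realType) (p : R) (p1 : 1 <= p) :
  completeNormedModType R := lp_sum p1 (fun n => linfty R n.+1).

Definition locally_finite (R : realType) (A : metricType R) : Prop :=
  forall (x : A) (r : R), finite_set (ball x r).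

Section distortion.
Context (R : realType) (A : metricType R) (X : normedModType R).

(* A map defined on a subset [S] of [A] is represented by any of its
   extensions to [A]: only the values on [S] matter. *)
Definition bilipschitz_on (S : set A) (C : R) (f : A -> X) : Prop :=
  1 <= C /\
  exists2 r : R, 0 < r & forall u v, S u -> S v ->
    r * mdist u v <= `|f u - f v| <= r * C * mdist u v.

Definition is_distortion (S : set A) (f : A -> X) (c : R) : Prop :=
  bilipschitz_on S c f /\ forall C, bilipschitz_on S C f -> c <= C.

Definition embeds_with_distortion_le (S : set A) (C : R) : Prop :=
  exists f : A -> X, exists2 c, is_distortion S f c & c <= C.

Lemma bilipschitz_on_le (S : set A) (C C' : R) (f : A -> X) :
  C <= C' -> bilipschitz_on S C f -> bilipschitz_on S C' f.
Proof.
move=> CC' [C1 [r r0 fr]]; split; first exact: le_trans CC'.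
exists r => // u v Su Sv; have /andP[-> /le_trans ->//] := fr u v Su Sv.
by rewrite ler_wpM2r ?mdist_ge0// ler_wpM2l// ltW.
Qed.

Lemma bilipschitz_on_distortion (S : set A) (C : R) (f : A -> X) :
  bilipschitz_on S C f -> exists2 c, is_distortion S f c & c <= C.
Proof.
move=> fC; pose I := [set c | bilipschitz_on S c f].
have I_inf : has_inf I by split; [exists C | exists 1 => c []].
have infP c : I c -> inf I <= c by move=> Ic; apply: ge_inf => //; case: I_inf.
exists (inf I); last exact: infP.
split=> //; split; first by apply: lb_le_inf; [case: I_inf|move=> c []].
have c0 : 0 < inf I.
  by apply: (@lt_le_trans _ _ 1) => //; apply: lb_le_inf; [case: I_inf|move=> c []].
have cross u v u' v' : S u -> S v -> S u' -> S v' ->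
    `|f u' - f v'| * mdist u v <= inf I * (`|f u - f v| * mdist u' v').
  move=> Su Sv Su' Sv'; rewrite mulrC.
  have h c : I c -> mdist u v * `|f u' - f v'| <= c * (`|f u - f v| * mdist u' v').
    move=> [c1 [r r0 fr]].
    have /andP[lo _] := fr u v Su Sv; have /andP[_ hi] := fr u' v' Su' Sv'.
    apply: (le_trans (ler_wpM2l (mdist_ge0 u v) hi)).
    have -> : mdist u v * (r * c * mdist u' v') = c * (r * mdist u v * mdist u' v').
      by ring.
    rewrite ler_wpM2l ?(le_trans _ c1)//.
    by rewrite ler_wpM2r ?mdist_ge0.
  have [k0|k0] := eqVneq (`|f u - f v| * mdist u' v') 0.
    by have := h _ fC; rewrite k0 !mulr0.
  have kp : 0 < `|f u - f v| * mdist u' v'.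
    by rewrite lt_neqAle eq_sym k0 mulr_ge0 ?mdist_ge0.
  rewrite -ler_pdivrMr//; apply: lb_le_inf; first by case: I_inf.
  by move=> c Ic; rewrite ler_pdivrMr// h.
have [C1 [r0 r00 fr0]] := fC.
pose Q := [set r | forall u v, S u -> S v -> r * mdist u v <= `|f u - f v|].
have Qr0 : Q r0 by move=> u v Su Sv; have /andP[] := fr0 u v Su Sv.
have [[a [b [Sa Sb ab]]]|triv] := pselect (exists a b, [/\ S a, S b & a != b]); last first.
  exists 1 => // u v Su Sv; have [->|uv] := eqVneq u v.
    by rewrite mdistxx !mulr0 subrr normr0 lexx.
  by case: triv; exists u, v.
have dab : 0 < mdist a b by rewrite mdist_gt0.
have Qub : has_sup Q.
  split; first by exists r0.
  by exists (`|f a - f b| / mdist a b) => r Qr; rewrite ler_pdivlMr// Qr.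
exists (sup Q).
  by apply: (lt_le_trans r00); apply: ub_le_sup => //; case: Qub.
move=> u v Su Sv; have [->|uv] := eqVneq u v.
  by rewrite mdistxx !mulr0 subrr normr0 lexx.
have duv : 0 < mdist u v by rewrite mdist_gt0.
apply/andP; split.
  rewrite -ler_pdivlMr//; apply: ge_sup; first by case: Qub.
  by move=> r Qr; rewrite ler_pdivlMr// Qr.
rewrite -!ler_pdivrMr//.
apply: ub_le_sup; first by case: Qub.
move=> u' v' Su' Sv'.
rewrite mulrAC ler_pdivrMr// mulrAC ler_pdivrMr//.
apply: (le_trans (cross u' v' u v Su' Sv' Su Sv)).
by rewrite mulrCA mulrA.
Qed.

End distortion.
Arguments embeds_with_distortion_le {R A} X S C.

Section D.
Context (R : realType) (X : completeNormedModType R).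

Definition D_le (alpha : R) : Prop :=
  1 <= alpha /\
  forall C : R, 1 <= C -> forall A : metricType R, locally_finite A ->
    (forall F : set A, finite_set F -> embeds_with_distortion_le X F C) ->
    embeds_with_distortion_le X [set: A] (alpha * C).

Definition D_eq (alpha : R) : Prop :=
  D_le alpha /\ forall beta, D_le beta -> alpha <= beta.

Definition D_eq_plus (alpha : R) : Prop :=
  [/\ 1 <= alpha, forall eps, 0 < eps -> D_le (alpha + eps) & ~ D_le alpha].

Definition D_lt_plus (alpha : R) : Prop :=
  (exists2 beta, D_eq beta & beta <= alpha) \/
  (exists2 beta, D_eq_plus beta & beta < alpha).

Definition D_ge_plus (alpha : R) : Prop := ~ D_lt_plus alpha.

Lemma D_ge_plus1 : D_ge_plus 1 <-> ~ D_le 1.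
Proof.
split=> [h D1|h [[b [Db _] b1]|[b [b1 _ _] /lt_geF]]]; last by rewrite b1.
- by apply: h; left; exists 1 => //; split=> // b [].
- by apply: h; have <- : b = 1 by apply/eqP; rewrite eq_le b1; case: Db.
Qed.

End D.

(* Main.v *)
(* Every finite metric space has a Frechet embedding into a single summand, so
   it suffices to find a locally finite space with no isometric copy, up to
   scaling, in the sum. Take a star with legs of length 1, 2, 3, ... Its centre
   lies between any two leaves, and since the l_p norm is strictly convex, the
   equality [|x - y| = |x| + |y|] in the sum holds in every summand, with norms
   in each summand proportional to those in the sum. So one finite-dimensional
   summand would contain infinitely many nonzero vectors with pairwise
   [|x - y| = |x| + |y|], whereas l_infty^n contains at most 2^n of them. *)

Require Import Defs.
From HB Require Import structures.
From mathcomp Require Import all_boot all_order all_algebra.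
From mathcomp Require Import all_classical all_reals all_analysis.
From mathcomp Require Import ring lra.
Import Order.TTheory GRing.Theory Num.Theory.
Import numFieldNormedType.Exports.
Local Open Scope classical_set_scope.
Local Open Scope ring_scope.

Set Implicit Arguments.
Unset Strict Implicit.
Unset Printing Implicit Defensive.

(** * Strict convexity of the power function *)

Lemma powR_bernoulli_lt (R : realType) (p y : R) :
  1 < p -> 0 <= y -> y != 1 -> 1 + p * (y - 1) < y `^ p.
Proof.
move=> p1; rewrite le_eqVlt => /predU1P[<- _|y0 y1].
  by rewrite powR0; [lra|rewrite gt_eqF// (lt_trans _ p1)].
have L0 : ln y != 0.
  by apply: contra y1 => /eqP yL; rewrite -(lnK y0) yL expR0.
(* With [y = exp L], the claim is the sum of [1 + s < exp s] at [s = - L] and at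
   [s = (p - 1) * L], weighted by [(p - 1) * exp L] and [exp L]. *)
rewrite /powR gt_eqF//; set L := ln y in L0 *.
have -> : y = expR L by rewrite lnK.
have pL0 : (p - 1) * L != 0 by rewrite mulf_neq0// subr_eq0 gt_eqF.
have NL0 : - L != 0 by rewrite oppr_eq0.
have := expR_gt1Dx pL0; have := expR_gt1Dx NL0.
rewrite -(ltr_pM2l (expR_gt0 L)) -expRD subrr expR0 => h1.
rewrite -(ltr_pM2l (expR_gt0 L)) -expRD.
have -> : L + (p - 1) * L = p * L by ring.
move=> h2; apply: lt_trans h2.
have : (p - 1) * (expR L * (1 - L)) < (p - 1) * 1.
  by rewrite ltr_pM2l// subr_gt0.
lra.
Qed.

(** After division by m^p this is the sum of the Bernoulli inequalities at [a / m] and [b / m] with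
    weights [t] and [1 - t]: the weighted mean of these two points is 1, so the linear terms
    cancel. *)
Lemma powR_strictly_convex (R : realType) (p t a b : R) :
  1 < p -> 0 < t < 1 -> 0 <= a -> 0 <= b -> a != b ->
  (t * a + (1 - t) * b) `^ p < t * a `^ p + (1 - t) * b `^ p.
Proof.
move=> p1 /andP[t0 t1] a0 b0 ab; set m := t * a + (1 - t) * b.
have t'0 : 0 < 1 - t by rewrite subr_gt0.
have m0 : 0 < m.
  rewrite /m; have [a_0|an0] := eqVneq a 0.
    rewrite ltr_wpDl ?mulr_ge0 ?(ltW t0)// mulr_gt0//.
    by rewrite lt_neqAle b0 andbT -a_0.
  by rewrite ltr_pwDl// ?mulr_ge0 ?(ltW t'0)// mulr_gt0// lt_neqAle a0 eq_sym an0.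
have scale c : 0 <= c -> c `^ p = m `^ p * (c / m) `^ p.
  move=> c0; rewrite -powRM ?(ltW m0)//; last by rewrite divr_ge0// ltW.
  by rewrite mulrC divfK// gt_eqF.
have bern c : 0 <= c -> c - m != 0 -> 1 + p * (c / m - 1) < (c / m) `^ p.
  move=> c0 cm; apply: powR_bernoulli_lt => //; first by rewrite divr_ge0// ltW.
  by apply: contra cm => /eqP cm1; rewrite -(divfK (lt0r_neq0 m0) c) cm1 mul1r subrr.
have ha : 1 + p * (a / m - 1) < (a / m) `^ p.
  apply: bern => //; have -> : a - m = (1 - t) * (a - b) by rewrite /m; ring.
  by rewrite mulf_neq0 ?subr_eq0// gt_eqF.
have hb : 1 + p * (b / m - 1) < (b / m) `^ p.
  apply: bern => //; have -> : b - m = t * (b - a) by rewrite /m; ring.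
  by rewrite mulf_neq0 ?subr_eq0 ?(eq_sym b)// gt_eqF.
rewrite (scale a)// (scale b)// mulrCA (mulrCA (1 - t)) -mulrDr.
rewrite -[ltLHS]mulr1 ltr_pM2l ?powR_gt0//.
have e : t * (1 + p * (a / m - 1)) + (1 - t) * (1 + p * (b / m - 1)) = 1.
  by rewrite /m; field; rewrite -/m gt_eqF.
by rewrite -[ltLHS]e ltrD// ltr_pM2l.
Qed.

(** * Equality cases of the l_p-sum norm, and inclusions of the summands *)

Section lp_sum_geometry.
Context (R : realType) (p : R) (p1 : 1 <= p) (E : nat -> completeNormedModType R).
Local Notation X := (lp_sum p1 E).

(** In each summand |z k|^p <= (t |u k| + (1 - t) |v k|)^p <= F k. The two ends both sum to 1, so
    equality holds throughout for every k. Strict convexity then gives |u n| = |v n|, whence |z n| =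
    |u n|. *)
Lemma lp_sum_unit_rigid (u v : X) (t : R) (n : nat) :
  1 < p -> 0 < t < 1 ->
  `|u| = 1 -> `|v| = 1 -> `|t *: u + (1 - t) *: v| = 1 ->
  `|u n| = `|v n| /\ `|t *: u n + (1 - t) *: v n| = `|u n|.
Proof.
move=> hp t01 u1 v1 z1; have /andP[t0 t1] := t01.
set z := t *: u + (1 - t) *: v in z1 *.
have t'0 : 0 < 1 - t by rewrite subr_gt0.
have p0 : 0 < p by rewrite (lt_trans _ hp).
pose F k := t * `|u k| `^ p + (1 - t) * `|v k| `^ p.
have zle k : `|z k| <= t * `|u k| + (1 - t) * `|v k|.
  apply: (le_trans (ler_normD _ _)).
  by rewrite !normrZ (gtr0_norm t0) (gtr0_norm t'0).
have zpow k : `|z k| `^ p <= (t * `|u k| + (1 - t) * `|v k|) `^ p.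
  rewrite ge0_ler_powR ?(ltW p0)// nnegrE//.
  by rewrite addr_ge0// mulr_ge0 ?(ltW t0) ?(ltW t'0).
have zF k : `|z k| `^ p <= F k.
  apply: (le_trans (zpow k)); have [e|/eqP uv] := pselect (`|u k| = `|v k|).
    by rewrite /F e -!mulrDl subrKC !mul1r.
  by apply/ltW/powR_strictly_convex.
have sumF : (\sum_(k <oo) (F k)%:E = 1)%E.
  transitivity (t%:E * psum p u + (1 - t)%:E * psum p v)%E.
    rewrite /psum -!nneseriesZl//; try by move=> k _; rewrite lee_fin powR_ge0.
    by rewrite -nneseriesD// => k _ _; rewrite lee_fin mulr_ge0 ?powR_ge0 ?ltW.
  by rewrite !psum_normE u1 v1 powR1 -!EFinM -EFinD !mulr1 subrKC.
have sumD : (\sum_(k <oo) (F k - `|z k| `^ p)%:E = 0)%E.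
  have : (\sum_(k <oo) (F k)%:E = psum p z + \sum_(k <oo) (F k - `|z k| `^ p)%:E)%E.
    rewrite /psum -nneseriesD; last 2 first.
    - by move=> k _ _; rewrite lee_fin powR_ge0.
    - by move=> k _ _; rewrite lee_fin subr_ge0.
    by apply: eq_eseriesr => k _; rewrite -EFinD subrKC.
  rewrite sumF psum_normE z1 powR1.
  (* The identity 1 = 1 + d excludes an infinite d, after which 1 can be cancelled. *)
  case: (\sum_(k <oo) _)%E => [d| |] //.
  by rewrite -EFinD => -[d1]; congr _%:E; apply: (addrI 1); rewrite -d1 addr0.
have Fz : `|z n| `^ p = F n.
  apply/eqP; rewrite eq_le zF/= -subr_le0 -lee_fin -[leRHS]/0%E -sumD.
  have D0 k : predT k -> (0 <= (F k - `|z k| `^ p)%:E)%E.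
    by move=> _; rewrite lee_fin subr_ge0.
  apply: (le_trans _ (nneseries_lim_ge n.+1 (fun k _ => D0 k))).
  by rewrite big_nat_recr//= leeDr// sume_ge0.
have uv : `|u n| = `|v n|.
  apply/eqP/negPn/negP => uv.
  have := powR_strictly_convex hp t01 (normr_ge0 (u n)) (normr_ge0 (v n)) uv.
  by rewrite -/(F n) -Fz ltNge zpow.
split=> //; have : `|z n| `^ p = `|u n| `^ p.
  by rewrite Fz /F -uv -mulrDl subrKC mul1r.
by apply: (powR_injective p0); rewrite nnegrE.
Qed.

(** The weight [t = s / (s + w)] turns the convex combination of the unit vectors x / s and y / w
    into (x + y) / (s + w), again a unit vector, so [lp_sum_unit_rigid] applies. *)
Lemma lp_sum_norm_additive (x y : X) (s w : R) (n : nat) :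
  1 < p -> 0 < s -> 0 < w -> `|x| = s -> `|y| = w -> `|x + y| = s + w ->
  `|x n| / s = `|y n| / w /\ `|x n + y n| = `|x n| + `|y n|.
Proof.
move=> hp s0 w0 xs yw xy; have sw0 : 0 < s + w by rewrite addr_gt0.
have snz := lt0r_neq0 s0; have wnz := lt0r_neq0 w0; have swnz := lt0r_neq0 sw0.
pose t := s / (s + w).
have t01 : 0 < t < 1 by rewrite divr_gt0//= ltr_pdivrMr// mul1r ltrDl.
have coef (V : lmodType R) (a b : V) :
    t *: (s^-1 *: a) + (1 - t) *: (w^-1 *: b) = (s + w)^-1 *: (a + b).
  rewrite scalerDr !scalerA; congr (_ *: _ + _ *: _); rewrite /t; field.
    by rewrite swnz.
  by rewrite swnz.
have normV (c : R) (W : normedModType R) (a : W) : 0 < c -> `|c^-1 *: a| = `|a| / c.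
  by move=> c0; rewrite normrZ gtr0_norm ?invr_gt0// mulrC.
have [] := @lp_sum_unit_rigid (s^-1 *: x) (w^-1 *: y) t n hp t01.
- by rewrite normV// xs mulfV.
- by rewrite normV// yw mulfV.
- by rewrite coef normV// xy mulfV.
rewrite !lp_sumZE coef !normV// => e1 e2; split=> //.
have -> : `|x n + y n| = s * (`|x n| / s) + w * (`|x n| / s).
  by rewrite -e2; field.
by rewrite {2}e1; field; rewrite wnz.
Qed.

Lemma lp_sum_norm_antipodal (x y : X) (s w : R) (n : nat) :
  1 < p -> 0 < s -> 0 < w -> `|x| = s -> `|y| = w -> `|x - y| = s + w ->
  `|x n| / s = `|y n| / w /\ `|x n - y n| = `|x n| + `|y n|.
Proof.
move=> hp s0 w0 xs yw xy; have yw' : `|- y| = w by rewrite normrN.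
have := lp_sum_norm_additive n hp s0 w0 xs yw' xy.
by rewrite lp_sumNE normrN.
Qed.

Lemma psum_dfwith N (x : E N) :
  psum p (dfwith (fun n => 0 : E n) N x) = (`|x| `^ p)%:E.
Proof.
rewrite /psum (@nneseriesD1 _ _ N)//.
rewrite dfwithin eseries0 ?adde0// => k _ /= kN.
by rewrite dfwithout 1?eq_sym// normr0 powR0// gt_eqF// (lt_le_trans _ p1).
Qed.

Lemma psum_dfwith_lty N (x : E N) :
  (psum p (dfwith (fun n => 0%R : E n) N x) < +oo)%E.
Proof. by rewrite psum_dfwith ltry. Qed.

Definition lp_sum_single N (x : E N) : X := LpSum p1 _ (psum_dfwith_lty x).

Lemma lp_sum_singleB N (x y : E N) :
  lp_sum_single x - lp_sum_single y = lp_sum_single (x - y).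
Proof.
apply: lp_sum_ext => n; rewrite lp_sumBE /=.
have [<-|Nn] := eqVneq N n; first by rewrite !dfwithin.
by rewrite !dfwithout// subr0.
Qed.

Lemma norm_lp_sum_single N (x : E N) : `|lp_sum_single x| = `|x|.
Proof.
have p0 : 0 < p by rewrite (lt_le_trans _ p1).
apply: (powR_injective p0); rewrite ?nnegrE//.
by apply: EFin_inj; rewrite -psum_normE psum_dfwith.
Qed.

End lp_sum_geometry.

(** * Antipodal families and Frechet embeddings in l_infty^n *)

Lemma le_linfty_norm (R : realType) n (x : linfty R n) (i : 'I_n) :
  `|(x : 'rV[R]_n) ord0 i| <= `|x|.
Proof. by rewrite linfty_normE; exact: (le_bigmax _ (fun i => `|_ i|)). Qed.

Lemma linfty_norm_attained (R : realType) n (x : linfty R n.+1) :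
  exists i, `|x| = `|(x : 'rV[R]_n.+1) ord0 i|.
Proof.
rewrite linfty_normE.
have [//|i _ ->] := @eq_bigmax _ _ _ 0 ord0 predT
  (fun i => `|(x : 'rV[R]_n.+1) ord0 i|) isT.
by exists i.
Qed.

(* At a coordinate where the norm of [h i - h j] is attained, one of [h i] and
   [h j] equals its norm and the other is minus its norm; so [i] is determined
   by the set of coordinates at which [h i] equals its norm. *)
Lemma linfty_antipodal_card (R : realType) n (I : finType)
    (h : I -> linfty R n.+1) :
  (forall i, h i != 0) ->
  (forall i j, i != j -> `|h i - h j| = `|h i| + `|h j|) ->
  (#|I| <= 2 ^ n.+1)%N.
Proof.
move=> h0 hB; pose c i k := (h i : 'rV[R]_n.+1) ord0 k.
pose S i := [set k | c i k == `|h i|]%SET.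
have hpos i : 0 < `|h i| by rewrite normr_gt0.
have S_inj : injective S.
  move=> i j Sij; apply/eqP/negPn/negP => ij.
  have [k hk] := linfty_norm_attained (h i - h j).
  have {}hk : `|c i k - c j k| = `|h i| + `|h j| by rewrite -hB// hk !mxE.
  have := le_linfty_norm (h i) k; have := le_linfty_norm (h j) k.
  rewrite -/(c i k) -/(c j k) !ler_norml => /andP[j1 j2] /andP[i1 i2].
  have := hpos i; have := hpos j => jp ip.
  move/setP: Sij => /(_ k); rewrite !inE.
  move: hk; case: (ger0P (c i k - c j k)) => _ hk.
    have -> : c i k = `|h i| by lra.
    by rewrite eqxx => /esym/eqP ?; lra.
  have -> : c j k = `|h j| by lra.
  by rewrite eqxx => /eqP ?; lra.
have := leq_card S S_inj.
by rewrite -[X in (_ <= X)%N]cardsT -powersetT card_powerset cardsT card_ord.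
Qed.

Lemma finite_set_embeds (R : realType) (p : R) (p1 : 1 <= p)
    (A : metricType R) (F : set A) : finite_set F ->
  embeds_with_distortion_le (lp_sum_linfty p1) F 1.
Proof.
move=> /finite_seqP[s ->].
suff [f fP] : exists f : A -> lp_sum_linfty p1,
    forall u v, u \in s -> v \in s -> `|f u - f v| = mdist u v.
  exists f; apply: bilipschitz_on_distortion; split=> //.
  by exists 1 => // u v us vs; rewrite fP// !mul1r lexx.
case: s => [|x0 s]; first by exists (fun=> 0).
(* The summand of index [size s] has dimension [(size s).+1]: one coordinate for each entry of
   [x0 :: s]. *)
pose g u : linfty R (size s).+1 := \row_j mdist u (nth x0 (x0 :: s) j).
exists (fun u => lp_sum_single p1 (N := size s) (g u)) => u v us vs.
rewrite lp_sum_singleB norm_lp_sum_single; apply/eqP; rewrite eq_le.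
apply/andP; split.
  rewrite linfty_normE; apply/bigmax_leP; split=> [|j _]; first exact: mdist_ge0.
  rewrite !mxE ler_norml; set w := nth _ _ _.
  have := metric_triangle u v w; have := metric_triangle v u w.
  by rewrite (metric_sym v u); lra.
(* The coordinate belonging to [v] is [mdist u v - mdist v v], which gives the lower bound. *)
have vlt : (index v (x0 :: s) < (size s).+1)%N by rewrite -index_mem in vs.
have := le_linfty_norm (g u - g v) (Ordinal vlt).
by rewrite !mxE nth_index// mdistxx subr0 ger0_norm ?mdist_ge0.
Qed.

(* The metric of a star: the leg ending at [i] has length [i], and [0] is the
   centre. *)
Definition star (R : realType) : Type := nat.

(** * The star and its non-embeddability *)

Section star.
Context (R : realType).

Definition star_dist (i j : star R) : R :=
  if (i : nat) == j then 0 else ((i : nat) + j)%:R.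

Lemma star_distxx i : star_dist i i = 0.
Proof. by rewrite /star_dist eqxx. Qed.

Lemma star_dist_positivity i j : star_dist i j = 0 -> i = j.
Proof.
rewrite /star_dist; case: eqVneq => // ij /eqP; rewrite pnatr_eq0 addn_eq0.
by case/andP => /eqP i0 /eqP j0; rewrite i0 j0 in ij.
Qed.

Lemma star_dist_sym i j : star_dist i j = star_dist j i.
Proof. by rewrite /star_dist eq_sym addnC. Qed.

Lemma star_dist_triangle j i k :
  star_dist i k <= star_dist i j + star_dist j k.
Proof.
rewrite /star_dist.
case: (eqVneq (i : nat) j) => [->|ij]; first by rewrite add0r.
case: (eqVneq (j : nat) k) => [->|jk]; first by rewrite addr0; case: ifP.
rewrite -natrD; case: eqVneq => // ik; rewrite ler_nat.
by rewrite leq_add// ?leq_addr// leq_addl.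
Qed.

HB.instance Definition _ := Choice.copy (star R) nat.
HB.instance Definition _ := isMetric.Build R (star R)
  star_distxx star_dist_positivity star_dist_sym star_dist_triangle.

Lemma star_mdistE (i j : star R) :
  mdist i j = if (i : nat) == j then 0 else ((i : nat) + j)%:R.
Proof. by []. Qed.

Lemma star_locally_finite : locally_finite (star R).
Proof.
(* A point [j] of the ball other than [i] satisfies j <= i + j < r; the bound [i.+1] takes care of
   [i] itself. *)
move=> i r; apply: (sub_finite_set _ (finite_II (maxn i.+1 (Num.bound r)))).
move=> j; rewrite ballEmdist /= star_mdistE leq_max.
have [<- _|_ ijr] := eqVneq (i : nat) j; first by rewrite ltnSn.
have r0 : 0 <= r by apply: le_trans (ltW ijr).
apply/orP; right; rewrite -(ltr_nat R).
apply: le_lt_trans (lt_trans ijr (archi_boundP r0)).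
by rewrite ler_nat leq_addl.
Qed.

End star.

Lemma lp_sum_linfty_no_star (R : realType) (p : R) (p1 : 1 <= p)
    (g : nat -> lp_sum p1 (fun n => linfty R n.+1)) (r : R) :
  1 < p -> 0 < r -> (forall i, `|g i| = r * i%:R) ->
  ~ (forall i j, i != j -> `|g i - g j| = r * i%:R + r * j%:R).
Proof.
move=> hp r0 norm_g norm_gB.
have ri_gt0 i : (0 < i)%N -> 0 < r * i%:R by move=> i0; rewrite mulr_gt0// ltr0n.
have rigid i j k : (0 < i)%N -> (0 < j)%N -> i != j ->
    `|g i k| / (r * i%:R) = `|g j k| / (r * j%:R) /\
    `|g i k - g j k| = `|g i k| + `|g j k|.
  move=> i0 j0 ij.
  exact: (lp_sum_norm_antipodal k hp (ri_gt0 i i0) (ri_gt0 j j0)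
    (norm_g i) (norm_g j) (norm_gB i j ij)).
(* Proportionality of the norms carries a nonzero component of [g 1] in summand [k] over to every
   [g i] with i > 0. *)
have [k gk] : exists k, g 1%N k != 0.
  apply/not_existsP => g0; have := ri_gt0 1%N isT; rewrite -norm_g.
  have -> : g 1%N = 0.
    by apply: lp_sum_ext => k; have /negP/negPn/eqP := g0 k.
  by rewrite normr0 ltxx.
have gk_neq0 i : (0 < i)%N -> g i k != 0.
  move=> i0; have [->//|i1] := eqVneq i 1%N.
  have [e _] := rigid i 1%N k i0 isT i1; apply: contra gk => /eqP gik.
  move: e; rewrite gik normr0 mul0r => /esym/eqP.
  by rewrite mulf_eq0 invr_eq0 normr_eq0 (gt_eqF (ri_gt0 1%N isT)) orbF.
(* Summand [k] has dimension [k.+1], so one leaf more than 2^(k+1) suffices; the shift of the index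
   leaves out the centre, which is sent to 0. *)
have := @linfty_antipodal_card R k 'I_(2 ^ k.+1).+1 (fun i => g (i : nat).+1 k).
rewrite card_ord ltnn => H; suff : false by []; apply: H => [i|i j ij].
  exact: gk_neq0.
by have [] := rigid i.+1 j.+1 k isT isT ij.
Qed.

Lemma star_not_embeds (R : realType) (p : R) (hp : 1 < p) :
  ~ embeds_with_distortion_le (lp_sum_linfty (ltW hp)) [set: star R] 1.
Proof.
move=> [f [c [fc _] /bilipschitz_on_le/(_ fc)[_ [r r0 fr]]]].
(* With constant 1 the two bilipschitz bounds coincide. *)
have {}fr (i j : star R) : `|f i - f j| = r * mdist i j.
  by apply/eqP; rewrite eq_le andbC; have := fr i j I I; rewrite mulr1.
(* Translation by [f 0] moves the image of the centre to the origin. *)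
apply: (@lp_sum_linfty_no_star R p (ltW hp) (fun i => f i - f 0%N) r) => //.
  by move=> i; rewrite fr star_mdistE addn0; case: eqVneq => [->|].
move=> i j ij; rewrite opprB addrA subrK fr star_mdistE (negbTE ij).
by rewrite natrD mulrDr.
Qed.

Theorem theorem1p12 (R : realType) (p : R) (hp : 1 < p) :
  D_ge_plus (lp_sum_linfty (ltW hp)) 1.
Proof.
apply/D_ge_plus1 => -[_ /(_ 1 (lexx 1) (star R) (@star_locally_finite R))].
rewrite mulr1 => h; apply: (@star_not_embeds R p hp); apply: h => F finF.
exact: finite_set_embeds.
Qed.
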